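(* Let $V_k\subset\hat V_k\subset V$ be nested discrete (finite-dimensional) test spaces, let $u_\theta\in U_{NN}\subset U$, and let $\phi(u_\theta)\in V$, $\phi_k(u_\theta)\in V_k$, $\hat\phi_k(u_\theta)\in\hat V_k$ be the Riesz representatives of the residual $r(u_\theta,\cdot)$ in $V$, $V_k$, $\hat V_k$ respectively. Suppose the saturation assumption holds: there exists a constant $\beta\in[0,1)$ such that $$\|\phi(u_\theta)-\hat\phi_k(u_\theta)\|_V\le\beta\,\|\phi(u_\theta)-\phi_k(u_\theta)\|_V.$$ Then the global refinement indicator $\iota_k(\mathcal{T}_k;u_\theta)=\|\hat\phi_k(u_\theta)-\phi_k(u_\theta)\|_V$ satisfies $$\|\hat\phi_k(u_\theta)-\phi_k(u_\theta)\|_V\le\|\phi(u_\theta)-\phi_k(u_\theta)\|_V\le\frac{1}{\sqrt{1-\beta^2}}\,\|\hat\phi_k(u_\theta)-\phi_k(u_\theta)\|_V.$$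
   Context: Setting: $U$ and $V$ are (real) Hilbert spaces with norms $\|\cdot\|_U$, $\|\cdot\|_V$; $(\cdot,\cdot)_V$ is the inner product inducing $\|\cdot\|_V$. $b:U\times V\to\mathbb{R}$ is a bilinear form and $l\in V'$ a bounded linear functional such that: (1) there is $\mu>0$ with $b(w,v)\le\mu\|w\|_U\|v\|_V$ for all $w\in U$, $v\in V$; (2) there is $\alpha>0$ with $\sup_{0\ne v\in V}\frac{b(w,v)}{\|v\|_V}\ge\alpha\|w\|_U$ for all $w\in U$; (3) if $v\in V$ satisfies $b(w,v)=0$ for all $w\in U$, then $v=0$. For $w\in U$ the residual is $r(w,\cdot):=l(\cdot)-b(w,\cdot)\in V'$. The Riesz representatives are defined by: $(\phi(w),v)_V=r(w,v)$ for all $v\in V$; $(\phi_k(w),v)_V=r(w,v)$ for all $v\in V_k$; $(\hat\phi_k(w),v)_V=r(w,v)$ for all $v\in\hat V_k$. $U_{NN}=\{u_\theta:\theta\in\mathbb{R}^s\}\subset U$ is the set of functions representable by a fixed neural network architecture with parameter vector $\theta$; only $U_{NN}\subset U$ is assumed. $\mathcal{T}_k$ is the mesh underlying $V_k$ and $\hat V_k$ (where $V_k$ is the original test space and $\hat V_k$ an enriched one, e.g. of higher polynomial order); the global indicator is defined as $\iota_k(\mathcal{T}_k;u_\theta):=\|\hat\phi_k(u_\theta)-\phi_k(u_\theta)\|_V$. *)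

(* Defs.v *)
From HB Require Import structures.
From mathcomp Require Import all_boot all_order all_algebra.
From mathcomp Require Import sesquilinear.
From mathcomp Require Import all_classical all_reals all_analysis.

Set Implicit Arguments.
Unset Strict Implicit.
Unset Printing Implicit Defensive.

Import Order.TTheory GRing.Theory Num.Theory.
Import numFieldNormedType.Exports.

Local Open Scope classical_set_scope.
Local Open Scope ring_scope.

(* A real Hilbert space is a complete normed module [V] together with an
   inner product [dot : {dot V for idfun}] such that [induces_norm dot]. *)
Definition induces_norm (R : realType) (V : completeNormedModType R)
    (dot : {dot V for idfun}) : Prop :=
  forall v : V, `|v| = Num.sqrt (dot v v).

Definition bounded_functional (R : realType) (V : completeNormedModType R)
    (l : {linear V -> R^o}) : Prop :=
  bounded_near l (nbhs (0 : V)).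

Section BilinearForm.
Variables (R : realType) (U V : completeNormedModType R).
Variable b : {bilinear U -> V -> R | *%R & *%R}.

Definition bounded_form : Prop :=
  exists2 mu : R, 0 < mu & forall w v, b w v <= mu * `|w| * `|v|.

(* The real [sup] of an unbounded set is 0 by convention, but [bounded_form]
   bounds these quotients by mu * `|w|. If V = {0} the set is empty, and its
   [sup] is also 0. *)
Definition inf_sup_condition : Prop :=
  exists2 alpha : R, 0 < alpha &
    forall w, alpha * `|w| <= sup [set b w v / `|v| | v in [set v | v != 0]].

Definition adjoint_injective : Prop :=
  forall v, (forall w, b w v = 0) -> v = 0.

Definition residual (l : {linear V -> R^o}) (w : U) (v : V) : R := l v - b w v.

End BilinearForm.

Section TestSpaces.
Variables (R : realType) (V : completeNormedModType R).

Definition finite_dim_subspace (W : set V) : Prop :=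
  GRing.submod_closed (mem W) /\
  exists (n : nat) (e : 'I_n -> V),
    (forall i, W (e i)) /\
    forall v, W v -> exists c : 'I_n -> R, v = \sum_(i < n) c i *: e i.

Definition riesz_representative (dot : {dot V for idfun}) (W : set V)
    (f : V -> R) (x : V) : Prop :=
  W x /\ forall v, W v -> dot x v = f v.

End TestSpaces.

(* The mesh enters only through the two test spaces, hence only through
   the representatives [phik] and [hphik]. *)
Definition global_indicator (R : realType) (U V : completeNormedModType R)
    (phik hphik : U -> V) (w : U) : R :=
  `|hphik w - phik w|.

(* Main.v *)
(* Galerkin orthogonality: phi and hphik represent the same functional on hVk,
   so phi - hphik is orthogonal to hVk, which contains hphik - phik. Pythagoras
   gives |phi - phik|^2 = |phi - hphik|^2 + |hphik - phik|^2: dropping the first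
   term yields the lower bound, bounding it by saturation the upper bound. *)

Require Import Defs.
From mathcomp Require Import all_boot all_order all_algebra.
From mathcomp Require Import sesquilinear.
From mathcomp Require Import all_classical all_reals all_analysis.
Import Order.TTheory GRing.Theory Num.Theory.
Import numFieldNormedType.Exports.

Set Implicit Arguments.
Unset Strict Implicit.
Unset Printing Implicit Defensive.

Local Open Scope classical_set_scope.
Local Open Scope ring_scope.

Lemma norm_sqr_dot (R : realType) (V : completeNormedModType R)
    (dot : {dot V for idfun}) (v : V) :
  induces_norm dot -> `|v| ^+ 2 = dot v v.
Proof.
move=> ->; rewrite sqr_sqrtr //.
(* Strict positivity of the form is available only for nonzero vectors, so zero is treated apart. *)
have [->|v0] := eqVneq v 0; first by rewrite linear0r.
exact/ltW/neq0_dnorm_gt0.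
Qed.

Lemma norm_pythagoras (R : realType) (V : completeNormedModType R)
    (dot : {dot V for idfun}) (x y : V) :
  induces_norm dot -> dot x y = 0 -> `|x + y| ^+ 2 = `|x| ^+ 2 + `|y| ^+ 2.
Proof.
by move=> dotP xy0; rewrite !(norm_sqr_dot _ dotP) hnormDd.
Qed.

Lemma finite_dim_subspaceB (R : realType) (V : completeNormedModType R)
    (W : set V) (x y : V) :
  finite_dim_subspace W -> W x -> W y -> W (x - y).
Proof.
move=> [[_ Wlin] _] Wx Wy; apply/set_mem.
(* Submodule closure concerns [a *: u + v]; the difference is recast as [-1 *: y + x]. *)
by rewrite addrC -scaleN1r; apply: Wlin; apply/mem_set.
Qed.

Lemma riesz_representative_orthogonal (R : realType)
    (V : completeNormedModType R) (dot : {dot V for idfun}) (W1 W2 : set V)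
    (f : V -> R) (x1 x2 v : V) :
  riesz_representative dot W1 f x1 -> riesz_representative dot W2 f x2 ->
  W1 v -> W2 v -> dot (x1 - x2) v = 0.
Proof.
by move=> [_ x1P] [_ x2P] W1v W2v; rewrite linearBl /= x1P // x2P // subrr.
Qed.

(** Real-number core of the estimate: [e] stands for the error of [phik], [d] for that of [hphik],
    and [i] for the indicator. *)
Lemma pythagorean_saturation_bound (R : rcfType) (e d i beta : R) :
  0 <= e -> 0 <= d -> 0 <= i -> 0 <= beta -> beta < 1 ->
  e ^+ 2 = d ^+ 2 + i ^+ 2 -> d <= beta * e ->
  i <= e <= 1 / Num.sqrt (1 - beta ^+ 2) * i.
Proof.
move=> e0 d0 i0 beta0 beta1 eq_e le_d; apply/andP; split.
  by rewrite -(@ler_pXn2r _ 2) ?nnegrE // eq_e lerDr sqr_ge0.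
have beta2_lt1 : 0 < 1 - beta ^+ 2 by rewrite subr_gt0 expr_lt1.
rewrite div1r mulrC ler_pdivlMr ?sqrtr_gt0 //.
rewrite -(@ler_pXn2r _ 2) ?nnegrE ?mulr_ge0 ?sqrtr_ge0 //.
(* The goal becomes [e ^+ 2 <= i ^+ 2 + e ^+ 2 * beta ^+ 2]. Expanding only the left [e ^+ 2]
   cancels [i ^+ 2] and leaves the square of [d <= beta * e]. *)
rewrite exprMn (sqr_sqrtr (ltW beta2_lt1)) mulrBr mulr1 lerBlDr {1}eq_e addrC lerD2l.
by rewrite mulrC -exprMn ler_pXn2r ?nnegrE ?mulr_ge0.
Qed.

Theorem theorem5p6 (R : realType)
  (U V : completeNormedModType R)
  (dotU : {dot U for idfun}) (dotV : {dot V for idfun})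
  (dotU_norm : induces_norm dotU) (dotV_norm : induces_norm dotV)
  (b : {bilinear U -> V -> R | *%R & *%R})
  (l : {linear V -> R^o})
  (l_bounded : bounded_functional l)
  (b_bounded : bounded_form b)
  (b_inf_sup : inf_sup_condition b)
  (b_inj : adjoint_injective b)
  (s : nat) (u : 'rV[R]_s -> U)
  (Vk hVk : set V)
  (Vk_fin : finite_dim_subspace Vk) (hVk_fin : finite_dim_subspace hVk)
  (Vk_sub : Vk `<=` hVk)
  (phi phik hphik : U -> V)
  (phiP : forall w, riesz_representative dotV setT (residual b l w) (phi w))
  (phikP : forall w, riesz_representative dotV Vk (residual b l w) (phik w))
  (hphikP : forall w, riesz_representative dotV hVk (residual b l w) (hphik w))
  (theta : 'rV[R]_s)
  (beta : R) (beta_ge0 : 0 <= beta) (beta_lt1 : beta < 1)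
  (saturation : `|phi (u theta) - hphik (u theta)|
                <= beta * `|phi (u theta) - phik (u theta)|) :
  global_indicator phik hphik (u theta) <= `|phi (u theta) - phik (u theta)| /\
  `|phi (u theta) - phik (u theta)|
    <= 1 / Num.sqrt (1 - beta ^+ 2) * global_indicator phik hphik (u theta).
Proof.
(* Nestedness places both discrete representatives in [hVk], which makes their difference an
   admissible test vector. *)
have hVk_phik := Vk_sub _ (phikP (u theta)).1.
have hVk_hphik := (hphikP (u theta)).1.
have hVk_diff := finite_dim_subspaceB hVk_fin hVk_hphik hVk_phik.
have orth := riesz_representative_orthogonal
  (phiP (u theta)) (hphikP (u theta)) I hVk_diff.
have := norm_pythagoras dotV_norm orth.
(* The two orthogonal summands telescope through [hphik] to [phi - phik]. *)
rewrite addrA subrK => pyth; apply/andP.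
exact: (pythagorean_saturation_bound _ _ _ beta_ge0 beta_lt1 pyth saturation).
Qed.
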